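(* Let $\mathcal D$ be a DE2 scheme with stencil $V$, and let $M\in S_2^+$. If the consistency set of $\mathcal D$ contains a neighborhood of $M$, then there exists $(e,f,g)\in \mathrm{Hull}(V)^3$ which forms an $M$-obtuse superbase of $\mathbb Z^2$.
   Context: $\Omega\subset\mathbb R^2$ is a fixed convex open bounded set, $X:=\Omega\cap\mathbb Z^2$ is assumed non-empty, and $\mathbb U$ is the set of all maps $u:X\cup\partial\Omega\to\mathbb R$. An operator is a map $\mathcal D:\mathbb U\to\mathbb R^X$, $u\mapsto(\mathcal D u(x))_{x\in X}$. Second order differences: for $e\in\mathbb Z^2\setminus\{0\}$, $u\in\mathbb U$, $x\in X$, let $h^{\pm}:=1$ if $x\pm e\in\Omega$, and otherwise let $h^\pm$ be the unique element of $]0,1]$ with $x\pm h^\pm e\in\partial\Omega$; set $$\Delta_e u(x):=\frac{2}{h^++h^-}\left(\frac{u(x+h^+e)-u(x)}{h^+}+\frac{u(x-h^-e)-u(x)}{h^-}\right).$$ A stencil is a finite set $V\subset\mathbb Z^2\setminus\{0\}$ with $-e\in V$ for each $e\in V$. An operator $\mathcal D$ is a DE2 scheme (degenerate elliptic) with stencil $V$ iff for each $x\in X$ the quantity $\mathcal D u(x)$ is a non-decreasing, locally Lipschitz function of the second order differences $\Delta_eu(x)$, $e\in V$. A superbase of $\mathbb Z^2$ is a triplet $(e,f,g)\in(\mathbb Z^2)^3$ with $e+f+g=0$ and $|\det(f,g)|=1$. $S_2^+$ is the set of $2\times2$ real symmetric positive definite matrices (an open subset of the space of symmetric matrices $S_2$).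 For $M\in S_2^+$, a superbase $(e_0,e_1,e_2)$ is $M$-obtuse iff $\langle e_i,Me_j\rangle\le 0$ for all $0\le i<j\le 2$. For $M\in S_2^+$ let $u_M\in\mathbb U$, $u_M(x):=\frac12\langle x,Mx\rangle$. The consistency set of $\mathcal D$ is the set of $M\in S_2^+$ such that $\mathcal D u_M(x)=\det(M)$ for all $x\in X$. $\mathrm{Hull}$ denotes the convex hull in $\mathbb R^2$. *)

(* Defs.v *)
From mathcomp Require Import all_boot all_order all_algebra finmap.
From mathcomp Require Import all_classical all_reals all_analysis.

Set Implicit Arguments.
Unset Strict Implicit.
Unset Printing Implicit Defensive.

Import Order.TTheory GRing.Theory Num.Theory.
Import numFieldNormedType.Exports.

Local Open Scope classical_set_scope.
Local Open Scope ring_scope.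

Section Defs.
Variable R : realType.
Local Notation R2 := 'cV[R]_2.
Local Notation Z2 := 'cV[int]_2.

Definition of_int (e : Z2) : R2 := map_mx intr e.

Definition dotM (M : 'M[R]_2) (x y : R2) : R := (x^T *m M *m y) 0 0.

Definition S2 : set 'M[R]_2 := [set M | M^T = M].

Definition S2pos : set 'M[R]_2 :=
  [set M | S2 M /\ forall x : R2, x != 0 -> 0 < dotM M x x].

Definition boundary (A : set R2) : set R2 := closure A `\` interior A.

Definition hull (V : {fset Z2}) : set R2 :=
  smallest (@convex_set R R2) [set of_int e | e in [set` V]].

Section Domain.
Variable Omega : set R2.

Definition grid : set R2 := Omega `&` range of_int.

Definition dom : set R2 := grid `|` boundary Omega.

Definition gridfun : Type := dom -> R.

Definition operator : Type := gridfun -> grid -> R.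

(* [hstep x e] is $h^+$; $h^-$ is [hstep x (- e)]. *)
Definition hstep (x e : R2) : R :=
  if `[< Omega (x + e) >] then 1
  else get [set h : R | 0 < h <= 1 /\ boundary Omega (x + h *: e)].

(* [valL_ 0 u] extends [u] by 0 outside [dom]; for [x] in [grid] (and [Omega]
   convex, open and bounded) the three evaluation points below lie in [dom]. *)
Definition Delta (e : Z2) (u : gridfun) (x : grid) : R :=
  let y := val x in
  let v := of_int e in
  let hp := hstep y v in
  let hm := hstep y (- v) in
  let w := valL_ 0 u in
  2 / (hp + hm) *
    ((w (y + hp *: v) - w y) / hp + (w (y - hm *: v) - w y) / hm).

Definition stencil (V : {fset Z2}) : Prop :=
  0 \notin V /\ forall e, e \in V -> - e \in V.

Definition nondecreasing_coord n (F : 'rV[R]_n -> R) : Prop :=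
  forall a b : 'rV[R]_n, (forall i, a 0 i <= b 0 i) -> F a <= F b.

Definition locally_lipschitz n (F : 'rV[R]_n -> R) : Prop :=
  forall a : 'rV[R]_n, exists2 U, nbhs a U & [lipschitz F b | b in U].

(* Elements of $\mathbb R^V$ are row vectors indexed by the duplicate-free
   enumeration of [V]. *)
Definition DE2 (V : {fset Z2}) (D : operator) : Prop :=
  stencil V /\
  forall x : grid, exists F : 'rV[R]_#|` V| -> R,
    [/\ nondecreasing_coord F, locally_lipschitz F &
      forall u, D u x = F (\row_(i < #|` V|) Delta V`_i u x)].

Definition quad (M : 'M[R]_2) : gridfun := fun x => dotM M (val x) (val x) / 2.

Definition consistency_set (D : operator) : set 'M[R]_2 :=
  [set M | S2pos M /\ forall x : grid, D (quad M) x = \det M].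

End Domain.

Definition superbase (e f g : Z2) : Prop :=
  e + f + g = 0 /\ `|\det (row_mx f g : 'M[int]_2)| = 1.

Definition obtuse (M : 'M[R]_2) (e f g : Z2) : Prop :=
  [/\ dotM M (of_int e) (of_int f) <= 0,
      dotM M (of_int e) (of_int g) <= 0 &
      dotM M (of_int f) (of_int g) <= 0].

End Defs.

(* Main.v *)
Require Import Defs.
From mathcomp Require Import all_boot all_order all_algebra finmap.
From mathcomp Require Import all_classical all_reals all_analysis.
From mathcomp Require Import ring lra zify.

(** Both halves of the argument live in the plane of a superbase [(e, f, g)],
    where an integer vector [v] is read through the determinants [cross e v],
    [cross f v], [cross g v], whose sum is zero.

    On a quadratic function the scheme only sees the numbers [<v, N v>] with
    [v] in [V] ([Delta_quad]), so monotonicity turns consistency into a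
    comparison principle ([consistent_det_mono]): for consistent [N] and [N'],
    if [<v, N v> <= <v, N' v>] for all [v] in [V] then [det N <= det N'].

    Selling's reduction provides an [M]-obtuse superbase [(e, f, g)]
    ([ex_obtuse_superbase]). The differential of [det] at [M], applied to the
    quadratic form [v |-> - 2 * cross f v * cross g v], is [- 2 * <f, M g>],
    which is nonnegative, and becomes positive after moving [M] slightly so
    that the superbase is strictly obtuse. Were this form nonpositive at every
    vector of [V], adding a small multiple of it would increase none of the
    [<v, N v>] and yet increase the determinant, against the comparison principle.
    So some [v] in [V] has [cross f v * cross g v < 0], and likewise for the
    two other pairs ([separating_stencil_vector]).

    These three vectors suffice. The inequality for the pair [f, g] confines
    [v] to the open double sector around [e] that is bounded by the lines
    through [f] and [g]. If [a] lies in the double sector of [e], then for one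
    of the two other vectors, say [b], Cramer's rule writes [e] as a
    combination of [a] and [b] whose coefficients have absolute values summing
    to at most [1] ([cross_pairs_bound]); this is where integrality enters.
    As [V] is symmetric, [e] belongs to its hull ([superbase_hull]). *)

Import Order.TTheory GRing.Theory Num.Theory.
Import numFieldNormedType.Exports.

Local Open Scope classical_set_scope.
Local Open Scope ring_scope.

(** * Plane bilinear forms and determinants *)

Lemma sum2 (T : nmodType) (F : 'I_2 -> T) : \sum_(i < 2) F i = F 0 + F 1.
Proof.
rewrite !big_ord_recl big_ord0 addr0; congr (_ + F _); exact: val_inj.
Qed.

Lemma det2 (T : comNzRingType) (A : 'M[T]_2) :
  \det A = A 0 0 * A 1 1 - A 0 1 * A 1 0.
Proof.
rewrite (expand_det_row _ 0) sum2 /cofactor !det_mx11 !mxE /= expr0 mul1r.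
rewrite expr1 mulN1r mulrN.
by congr (_ * A _ _ - _ * A _ _); exact: val_inj.
Qed.

Definition cross {T : pzRingType} (x y : 'cV[T]_2) : T :=
  x 0 0 * y 1 0 - x 1 0 * y 0 0.

Lemma det_row_mx_cross (T : comNzRingType) (f g : 'cV[T]_2) :
  \det (row_mx f g : 'M[T]_2) = cross f g.
Proof.
rewrite det2.
have rmx0 i : row_mx f g i 0 = f i 0.
  by rewrite -(row_mxEl f g i 0); congr (row_mx f g i _); exact: val_inj.
have rmx1 i : row_mx f g i 1 = g i 0.
  by rewrite -(row_mxEr f g i 0); congr (row_mx f g i _); exact: val_inj.
by rewrite !rmx0 !rmx1 /cross; ring.
Qed.

Lemma crossC (T : comPzRingType) (x y : 'cV[T]_2) : cross x y = - cross y x.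
Proof. by rewrite /cross; ring. Qed.

Lemma crossxx (T : comPzRingType) (x : 'cV[T]_2) : cross x x = 0.
Proof. by rewrite /cross; ring. Qed.

Lemma cross_of_int (R : realType) (x y : 'cV[int]_2) :
  cross (of_int R x) (of_int R y) = (cross x y)%:~R.
Proof. by rewrite /cross !mxE !rmorphB !rmorphM. Qed.

Section BilinearForms.
Variable R : realType.
Implicit Types (N A B : 'M[R]_2) (x y z : 'cV[R]_2).

Lemma dotME N x y :
  dotM N x y = x 0 0 * N 0 0 * y 0 0 + x 0 0 * N 0 1 * y 1 0
             + x 1 0 * N 1 0 * y 0 0 + x 1 0 * N 1 1 * y 1 0.
Proof. by rewrite /dotM mxE sum2 !mxE !sum2 !mxE; ring. Qed.

Lemma dotMD A B x y : dotM (A + B) x y = dotM A x y + dotM B x y.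
Proof. by rewrite !dotME !mxE; ring. Qed.

Lemma dotM_perturb A B t x y :
  dotM (A + t *: B) x y = dotM A x y + t * dotM B x y.
Proof. by rewrite !dotME !mxE; ring. Qed.

Lemma S2_sym N : S2 N -> N 1 0 = N 0 1.
Proof. by move=> /= NT; rewrite -[in LHS]NT mxE. Qed.

Lemma dotMC N x y : S2 N -> dotM N x y = dotM N y x.
Proof. by move=> /S2_sym NE; rewrite !dotME NE; ring. Qed.

Lemma dotM_addZ_sq N x y t : S2 N ->
  dotM N (x + t *: y) (x + t *: y) =
  dotM N x x + 2 * t * dotM N x y + t ^+ 2 * dotM N y y.
Proof. by move=> /S2_sym NE; rewrite !dotME NE !mxE; ring. Qed.

Lemma dotMNr N x y : dotM N x (- y) = - dotM N x y.
Proof. by rewrite !dotME !mxE; ring. Qed.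

Lemma dotMNN N x : dotM N (- x) (- x) = dotM N x x.
Proof. by rewrite !dotME !mxE; ring. Qed.

Lemma S2D A B : S2 A -> S2 B -> S2 (A + B).
Proof. by rewrite /S2 /= => AT BT; rewrite linearD /= AT BT. Qed.

Lemma S2_perturb A B t : S2 A -> S2 B -> S2 (A + t *: B).
Proof. by rewrite /S2 /= => AT BT; rewrite linearD linearZ /= AT BT. Qed.

(** The Gram determinant of a basis is the determinant of the form times the
    squared determinant of the basis. *)
Lemma det_basis N x y : S2 N -> cross x y ^+ 2 = 1 ->
  \det N = dotM N x x * dotM N y y - dotM N x y ^+ 2.
Proof.
move=> /S2_sym NE xy1; rewrite -[LHS]mulr1 -xy1 det2 !dotME /cross NE; ring.
Qed.

(** Quarter turn, so that [(rot x)^T *m y] is [cross x y]. *)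
Definition rot x : 'cV[R]_2 := \col_i (if i == 0 then - x 1 0 else x 0 0).

(** The symmetrized product of the linear forms [cross x] and [cross y]; it is
    twice the polarization of [v |-> cross x v * cross y v]. *)
Definition cross_prod x y : 'M[R]_2 := rot x *m (rot y)^T + rot y *m (rot x)^T.

Lemma dotM_cross_prod x y v w :
  dotM (cross_prod x y) v w = cross x v * cross y w + cross y v * cross x w.
Proof. by rewrite dotME /cross !mxE !big_ord1 !mxE /=; ring. Qed.

Lemma S2_cross_prod x y : S2 (cross_prod x y).
Proof. by rewrite /S2 /= linearD /= !trmx_mul !trmxK addrC. Qed.

End BilinearForms.

Arguments cross_prod {R}.

(** * Superbases *)

(** Each cyclically consecutive pair of a superbase spans the same oriented
    area, since the third vector is minus the sum of the other two. *)
Lemma superbase_cross (e f g : 'cV[int]_2) : superbase e f g ->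
  exists2 s : int, s ^+ 2 = 1 & [/\ cross f g = s, cross g e = s & cross e f = s].
Proof.
move=> [/eqP]; rewrite det_row_mx_cross -addrA addr_eq0 => /eqP -> s1.
exists (cross f g); first by rewrite -real_normK ?num_real // s1 expr1n.
by rewrite /cross !mxE; split=> //; ring.
Qed.

Lemma superbase_rot (e f g : 'cV[int]_2) : superbase e f g -> superbase f g e.
Proof.
move=> sb; have [s _ [fg ge _]] := superbase_cross _ _ _ sb.
case: sb => efg; rewrite /superbase !det_row_mx_cross fg ge => ->.
by rewrite addrC addrA.
Qed.

Lemma obtuse_rot (R : realType) (M : 'M[R]_2) (e f g : 'cV[int]_2) :
  S2 M -> obtuse M e f g -> obtuse M f g e.
Proof. by move=> MT [ef eg fg]; split=> //; rewrite dotMC. Qed.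

(** * Existence of an obtuse superbase *)

Lemma finite_sublevel_min (R : realType) (T : choiceType) (E : T -> R)
    (P : set T) (x0 : T) :
  P x0 -> finite_set [set x | E x <= E x0] ->
  exists2 x, P x & forall y, P y -> E x <= E y.
Proof.
move=> Px0 fin.
have [X XE] : exists X : {fset T}, P `&` [set x | E x <= E x0] = [set` X].
  by apply/finite_fsetP; apply: sub_finite_set fin => x [].
have memX x : (x \in X) <-> P x /\ E x <= E x0.
  by split=> [xX|Px]; [have : [set` X] x by [] | suff : [set` X] x by []];
    rewrite -XE.
have x0X : x0 \in X by apply/memX.
have [m _ mmin] := @arg_minP _ _ _ [` x0X]%fset xpredT (fun x : X => E (val x)) isT.
have /memX[Pm Em] := valP m.
exists (val m) => // y Py; case: (leP (E y) (E x0)) => [yx0|/ltW yx0].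
  have yX : y \in X by apply/memX.
  exact: (mmin [` yX]%fset).
exact: le_trans Em yx0.
Qed.

Section Selling.
Variables (R : realType) (M : 'M[R]_2).
Hypothesis M_pos : S2pos M.
Local Notation ii := (of_int R).

Lemma S2pos_diag_det :
  [/\ 0 < M 0 0, 0 < M 1 1 & M 0 1 ^+ 2 < M 0 0 * M 1 1].
Proof.
case: M_pos => /S2_sym ME pos.
have posE (a b : R) : (a != 0) || (b != 0) ->
    0 < a ^+ 2 * M 0 0 + 2 * a * b * M 0 1 + b ^+ 2 * M 1 1.
  move=> ab0.
  have := pos (\col_i (if i == 0 then a else b)).
  rewrite dotME !mxE /= ME => H.
  have /H : (\col_i (if i == 0 then a else b) : 'cV[R]_2) != 0.
    apply: contraTneq ab0 => /matrixP abE.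
    have := abE 0 0; have := abE 1 0; rewrite !mxE /= => -> ->.
    by rewrite eqxx.
  by congr (_ < _); ring.
have a0 : 0 < M 0 0 by have := posE 1 0; rewrite oner_eq0 /= => /(_ isT); lra.
have c0 : 0 < M 1 1 by have := posE 0 1; rewrite oner_eq0 orbT /= => /(_ isT); lra.
split=> //.
(* The vector [(- M01, M00)] is M-orthogonal to the first basis vector. *)
have := posE (- M 0 1) (M 0 0); rewrite (gt_eqF a0) orbT => /(_ isT).
have -> : (- M 0 1) ^+ 2 * M 0 0 + 2 * - M 0 1 * M 0 0 * M 0 1 +
  M 0 0 ^+ 2 * M 1 1 = M 0 0 * (M 0 0 * M 1 1 - M 0 1 ^+ 2) by ring.
by rewrite pmulr_rgt0 // subr_gt0.
Qed.

Lemma dotM_ge0 x : 0 <= dotM M x x.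
Proof.
case: (eqVneq x 0) => [->|x0]; first by rewrite dotME !mxE; lra.
by apply/ltW; case: M_pos => _; apply.
Qed.

(** With [delta = a c - b^2 > 0], adding the two completions of the square
    [c <v, M v> = delta x^2 + (b x + c y)^2] and
    [a <v, M v> = delta y^2 + (a x + b y)^2] bounds [x^2 + y^2] by
    [(a + c) C / delta]. *)
Lemma finite_int_ball (C : R) : finite_set [set v | dotM M (ii v) (ii v) <= C].
Proof.
have [a0 c0 d0] := S2pos_diag_det; have ME := S2_sym _ _ M_pos.1.
set a := M 0 0 in a0 d0 *; set c := M 1 1 in c0 d0 *; set b := M 0 1 in d0 *.
pose n := `|Num.ceil ((a + c) * C / (a * c - b ^+ 2))|%N.
pose I : set int := (fun k : nat => k%:Z - n%:Z) @` `I_(n.*2.+1).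
have finI : finite_set I by apply: finite_image.
pose col2 (p : int * int) : 'cV[int]_2 := \col_i (if i == 0 then p.1 else p.2).
apply: (@sub_finite_set _ _ (col2 @` (I `*` I))); last first.
  by apply: finite_image; apply: finite_setX.
have memI (k : int) : (k ^+ 2)%:~R <= (a + c) * C / (a * c - b ^+ 2) -> I k.
  move=> kB; have : k ^+ 2 <= n%:Z.
    rewrite -(ler_int R); apply: le_trans kB _; apply: le_trans (ceil_ge _) _.
    by rewrite ler_int /n abszE ler_norm.
  by move=> kn; exists (absz (k + n%:Z)); rewrite /=; nia.
move=> v /=; rewrite dotME ME !mxE => vC.
exists (v 0 0, v 1 0); last first.
  by apply/colP => i; rewrite !mxE /=; case: eqVneq => [->//|i0]; congr (v _ _);
   apply: val_inj; case: i i0 => [[|[]]].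
have d0' : 0 < a * c - b ^+ 2 by rewrite subr_gt0.
pose x : R := (v 0 0)%:~R; pose y : R := (v 1 0)%:~R.
have sumB : (x ^+ 2 + y ^+ 2) * (a * c - b ^+ 2) <= (a + c) * C.
  have : 0 <= (a + c) * (C - (x * a * x + x * b * y + y * b * x + y * c * y)).
    by rewrite mulr_ge0 ?subr_ge0 // addr_ge0 ?ltW.
  have := sqr_ge0 (b * x + c * y); have := sqr_ge0 (a * x + b * y); nra.
have := mulr_ge0 (sqr_ge0 x) (ltW d0'); have := mulr_ge0 (sqr_ge0 y) (ltW d0').
by split; apply: memI; rewrite rmorphXn /= ler_pdivlMr // -/x -/y; lra.
Qed.

(** Selling's energy of the superbase [(- p.1 - p.2, p.1, p.2)]. *)
Definition energy (p : 'cV[int]_2 * 'cV[int]_2) : R :=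
  dotM M (ii p.1) (ii p.1) + dotM M (ii p.2) (ii p.2) +
  dotM M (ii (- p.1 - p.2)) (ii (- p.1 - p.2)).

(** A superbase of least energy is obtuse: replacing a pair [f, g] by [- f, g],
    and the third vector by [f - g], changes the energy by [- 4 <f, M g>]. *)
Lemma ex_obtuse_superbase :
  exists e f g, superbase e f g /\ obtuse M e f g.
Proof.
have symM := M_pos.1; have ME := S2_sym _ _ symM.
pose e1 : 'cV[int]_2 := \col_i (if i == 0 then 1 else 0).
pose e2 : 'cV[int]_2 := \col_i (if i == 0 then 0 else 1).
have [|//|p pdet pmin] := @finite_sublevel_min R _ energy
  [set p | `|cross p.1 p.2| = 1] (e1, e2).
- by rewrite /= /cross !mxE.
- apply: (@sub_finite_set _ _ ([set v | dotM M (ii v) (ii v) <= energy (e1, e2)]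
    `*` [set v | dotM M (ii v) (ii v) <= energy (e1, e2)])); last first.
    by apply: finite_setX; apply: finite_int_ball.
  move=> p /=; rewrite {1}/energy => pE.
  have := dotM_ge0 (ii p.1); have := dotM_ge0 (ii p.2).
  have := dotM_ge0 (ii (- p.1 - p.2)); split=> /=; lra.
case: p pdet pmin => f g /= fg pmin; exists (- f - g), f, g; split.
  by split; [rewrite -addrA -opprD addrC subrr | rewrite det_row_mx_cross].
have low f' g' : `|cross f' g'| = 1 -> energy (f, g) <= energy (f', g').
  by move=> fg'; exact: (pmin (f', g')).
(* The flips of the pairs (f, g), (e, f) and (e, g), with e = - f - g. *)
have h1 := low (- f) g; have h2 := low (- f - g) (- f); have h3 := low (- f - g) (- g).
move: h1 h2 h3.
have -> : cross (- f) g = - cross f g by rewrite /cross !mxE; ring.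
have -> : cross (- f - g) (- f) = - cross f g by rewrite /cross !mxE; ring.
have -> : cross (- f - g) (- g) = cross f g by rewrite /cross !mxE; ring.
rewrite normrN fg => /(_ erefl) h1 /(_ erefl) h2 /(_ erefl) h3.
move: h1 h2 h3; rewrite /energy /= !dotME ME !mxE !(rmorphD, rmorphN) /=.
by move=> h1 h2 h3; split; rewrite !dotME ME !mxE ?(rmorphD, rmorphN) /=; lra.
Qed.

End Selling.

(** * Recovering the superbase inside the hull *)

(** Here [(X, Y)], [(U, W)], [(P, Q)] are the coordinates
    [(cross e v, cross f v)] of integer vectors [a], [b], [c] in the double
    sectors of [e], [f] and [g]. If [a] is on the [f] side of [e], that is
    [X * Y < 0], then [b] works: when say [0 < X], [X + Y < 0], [0 < U] and
    [0 < U + W], the gap [X W - Y U - X - U] equals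
    [X (U + W - 1) + (- X - Y - 1) U], a sum of nonnegative terms because a
    positive integer is at least [1]. On the other side, [c] works. *)
Lemma cross_pairs_bound (X Y U W P Q : int) :
  0 < Y * (X + Y) -> 0 < U * (U + W) -> P * Q < 0 ->
  `|X| + `|U| <= `|X * W - Y * U| \/ `|X| + `|P| <= `|X * Q - Y * P|.
Proof.
have same_sign (x y : int) : 0 < x * y -> (0 < x /\ 0 < y) \/ (x < 0 /\ y < 0).
  by have [||->] := ltgtP x 0; have [||->] := ltgtP y 0; nia.
move=> Y_XY U_UW PQ; have Q_P : 0 < (- Q) * P by lia.
case/same_sign: Y_XY => -[Y0 XY0]; case/same_sign: U_UW => -[U0 UW0];
  case/same_sign: Q_P => -[Q0 P0]; have [X0|X0] := leP X 0;
  (left; nia) || (right; nia).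
Qed.

Section Hull.
Variables (R : realType) (V : {fset 'cV[int]_2}).
Hypothesis VN : forall e, e \in V -> - e \in V.
Local Notation ii := (of_int R).
Local Notation H := (hull V : set 'cV[R]_2).

Lemma of_intN e : ii (- e) = - ii e.
Proof. by apply/matrixP => i j; rewrite !mxE rmorphN. Qed.

Lemma hull_conv (x y : 'cV[R]_2) (t : R) : 0 <= t <= 1 ->
  H x -> H y -> H (t *: x + (1 - t) *: y).
Proof.
move=> t01 Hx Hy A [Aconv VA].
have := Aconv x y (Itv01 (andP t01).1 (andP t01).2).
by rewrite !inE; apply; [exact: Hx | exact: Hy].
Qed.

Lemma hull_mem v : v \in V -> H (ii v).
Proof. by move=> vV A [_]; apply; exists v. Qed.

(** The symmetry of [V] absorbs the signs of the coefficients, and also makes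
    up for a total weight below [1]. *)
Lemma hull_comb2 (a b : 'cV[int]_2) (s t : R) : a \in V -> b \in V ->
  `|s| + `|t| <= 1 -> H (s *: ii a + t *: ii b).
Proof.
have scale1 v (u : R) : v \in V -> `|u| <= 1 -> H (u *: ii v).
  move=> vV; rewrite ler_norml => u1.
  have -> : u *: ii v = ((1 + u) / 2) *: ii v + (1 - (1 + u) / 2) *: ii (- v).
    rewrite of_intN scalerN -scalerBl; congr (_ *: _); by field.
  by refine (hull_conv _ _ _ _ (hull_mem _ vV) (hull_mem _ (VN _ vV))); lra.
move=> aV bV st.
(* The general case normalizes the two coefficients by their signs and by
   their total weight, which needs both to be nonzero. *)
have [s0|s0] := eqVneq s 0.
  by rewrite s0 scale0r add0r; apply: scale1 => //; move: st; rewrite s0 normr0 add0r.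
have s_gt0 : 0 < `|s| by rewrite normr_gt0.
have t_ge0 := normr_ge0 t.
have [t0|t0] := eqVneq t 0.
  by rewrite t0 scale0r addr0; apply: scale1 => //; move: st; rewrite t0 normr0 addr0.
set k := `|s| + `|t| in st.
have k0 : 0 < k by rewrite /k; lra.
have t_gt0 : 0 < `|t| by rewrite normr_gt0.
have -> : s *: ii a + t *: ii b =
    (`|s| / k) *: ((s / `|s| * k) *: ii a) +
    (1 - `|s| / k) *: ((t / `|t| * k) *: ii b).
  rewrite !scalerA; congr (_ *: _ + _ *: _).
    by field; rewrite !gt_eqF.
  have -> : 1 - `|s| / k = `|t| / k by rewrite /k; field; rewrite gt_eqF.
  by field; rewrite !gt_eqF.
refine (hull_conv _ _ _ _ (scale1 _ _ aV _) (scale1 _ _ bV _)).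
- by rewrite divr_ge0 ?(ltW k0) //= ler_pdivrMr // mul1r /k lerDl.
- rewrite !normrM normfV normr_id divff ?gt_eqF // mul1r.
  by rewrite gtr0_norm.
- rewrite !normrM normfV normr_id divff ?gt_eqF // mul1r.
  by rewrite gtr0_norm.
Qed.

(** Cramer's rule: [cross a b *: e = cross e b *: a - cross e a *: b]. *)
Lemma hull_cramer (a b e : 'cV[int]_2) : a \in V -> b \in V ->
  cross a b != 0 -> `|cross e a| + `|cross e b| <= `|cross a b| -> H (ii e).
Proof.
move=> aV bV ab0 le_ab.
have abR : (cross a b)%:~R != 0 :> R by rewrite intr_eq0.
have -> : ii e = ((cross e b)%:~R / (cross a b)%:~R) *: ii a
              + (- (cross e a)%:~R / (cross a b)%:~R) *: ii b.
  have crossE : (cross a b)%:~R *: ii e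
      = (cross e b)%:~R *: ii a - (cross e a)%:~R *: ii b.
    apply/matrixP => i j; rewrite !mxE -!rmorphM -rmorphB; congr _%:~R.
    rewrite (ord1 j) /cross.
    have [->|->] : i = 0 \/ i = 1.
      by case: i => [[|[|//]]] ?; [left|right]; exact: val_inj.
    - by ring.
    - by ring.
  apply: (can_inj (scalerK abR)); rewrite crossE scalerDr !scalerA -scaleNr.
  by rewrite ![_ * (_ / _)]mulrC !divfK.
refine (hull_comb2 _ _ _ _ aV bV _).
rewrite !normrM normrN !normfV -mulrDl ler_pdivrMr ?normr_gt0 // mul1r.
by rewrite -!intr_norm -rmorphD ler_int addrC.
Qed.

(** One vector of [V] in each double sector: the one around [e], together with
    one of the other two, generates [e] with total weight at most [1]. *)
Lemma superbase_hull e f g : superbase e f g ->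
  (exists2 v, v \in V & cross f v * cross g v < 0) ->
  (exists2 v, v \in V & cross g v * cross e v < 0) ->
  (exists2 v, v \in V & cross e v * cross f v < 0) ->
  H (ii e).
Proof.
move=> sb [a aV a_fg] [b bV b_ge] [c cV c_ef].
have [s s1 [fg ge ef]] := superbase_cross _ _ _ sb.
have gE v : cross g v = - (cross e v + cross f v).
  have -> : cross g v = cross (e + f + g) v - cross e v - cross f v.
    by rewrite /cross !mxE; ring.
  by rewrite sb.1 /cross !mxE; ring.
have crossE v w : `|cross v w| = `|cross e v * cross f w - cross f v * cross e w|.
  have <- : cross e f * cross v w = cross e v * cross f w - cross f v * cross e w.
    by rewrite /cross; ring.
  have : `|s| ^+ 2 = 1 by rewrite -normrX s1.
  move=> /eqP; rewrite sqrp_eq1 // => /eqP sn.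
  by rewrite normrM ef sn mul1r.
have cross0 v w : cross e w != 0 ->
    `|cross e v| + `|cross e w| <= `|cross v w| -> cross v w != 0.
  by lia.
have [|||h|h] := cross_pairs_bound (cross e a) (cross f a)
  (cross e b) (cross f b) (cross e c) (cross f c).
- by move: a_fg; rewrite gE; lia.
- by move: b_ge; rewrite gE; lia.
- by [].
- rewrite -crossE in h; refine (hull_cramer _ _ _ aV bV (cross0 _ _ _ h) h).
  by apply: contraTneq b_ge => ->; rewrite mulr0.
- rewrite -crossE in h; refine (hull_cramer _ _ _ aV cV (cross0 _ _ _ h) h).
  by apply: contraTneq c_ef => ->; rewrite mul0r.
Qed.
End Hull.

(** * Consistent schemes compare determinants *)

Section Consistency.
Variables (R : realType) (Omega : set 'cV[R]_2).
Hypothesis Omega_open : open Omega.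
Local Notation ii := (of_int R).

(** The times at which the segment is outside [Omega] form a compact set, whose
    least element is the step: all earlier points are in [Omega], so the point
    reached is in its closure. *)
Lemma boundary_step (x e : 'cV[R]_2) : Omega x -> ~ Omega (x + e) ->
  exists h : R, 0 < h <= 1 /\ boundary Omega (x + h *: e).
Proof.
move=> Ox nOxe.
have path_cont : continuous (fun t : R => x + t *: e).
  by move=> t; apply: cvgD; [exact: cvg_cst | apply: cvgZr_tmp; exact: cvg_id].
pose A := `[0, 1]%classic `&` (fun t : R => x + t *: e) @^-1` (~` Omega).
have A1 : A 1 by split; rewrite /= ?scale1r // in_itv /= ler01 lexx.
have cA : compact A.
  apply: (subclosed_compact _ (@segment_compact R 0 1)); last by move=> t [].
  apply: closedI; first exact: interval_closed.
  by apply: closed_comp => [t _|]; [exact: path_cont | exact: open_closedC].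
have [||h] := @compact_EVT_min R R id A _ cA; first by exists 1.
  by apply: continuous_subspaceT => t; exact: cvg_id.
rewrite inE => -[/= h01 nOh] hmin.
move: h01; rewrite in_itv /= => /andP[h_ge0 h_le1].
have h_gt0 : 0 < h.
  rewrite lt_neqAle h_ge0 andbT; apply: contra_notN nOh => /eqP <-.
  by rewrite scale0r addr0.
exists h; split; first by rewrite h_gt0.
split; last by move/interior_subset.
have inO t : 0 < t < h -> Omega (x + t *: e).
  move=> /andP[t0 th]; apply: contrapT => nOt.
  have /hmin : t \in A.
    by rewrite inE; split=> //=; rewrite in_itv /= ltW //= (le_trans (ltW th)).
  by rewrite leNgt th.
move=> U /path_cont hU.
have hU' : \forall t \near h^'-, U (x + t *: e).
  exact: cvg_at_left_filter hU.
near h^'- => t.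
exists (x + t *: e); split; last by near: t.
apply: inO; apply/andP; split; near: t.
  exact: nbhs_left_gt.
exact: nbhs_left_lt.
Unshelve. all: by end_near. Qed.

Lemma hstep_dom (x v : 'cV[int]_2) : Omega (ii x) ->
  0 < hstep Omega (ii x) (ii v) /\
  dom Omega (ii x + hstep Omega (ii x) (ii v) *: ii v).
Proof.
move=> Ox; rewrite /hstep; case: asboolP => [Oxv|nOxv].
  split=> //; left; split; rewrite scale1r //.
  by exists (x + v) => //; apply/matrixP => i j; rewrite !mxE rmorphD.
have [[/andP[h0 _] bd]] := getPex (boundary_step _ _ Ox nOxv).
by split=> //; right.
Qed.

(** The weights of [Delta] cancel the linear part [<x, N v>] of the increments
    and normalize their quadratic part, whatever the two steps are. *)
Lemma Delta_quad (N : 'M[R]_2) (v : 'cV[int]_2) (x : grid Omega) :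
  S2 N -> Delta v (quad N) x = dotM N (ii v) (ii v).
Proof.
move=> symN; have [Ox [z _ zx]] : grid Omega (val x) by apply/set_mem/valP.
have quadE y : dom Omega y -> 'valL_ 0 (@quad R Omega N) y = dotM N y y / 2.
  move=> /mem_set yD.
  have := congr1 (fun u => u (SigSub yD)) (valLK 0 (@quad _ Omega N)).
  by rewrite sigLE.
rewrite -zx in Ox.
have [hp0 hpD] := hstep_dom _ v Ox; have [hm0] := hstep_dom _ (- v) Ox.
rewrite of_intN in hm0 *; rewrite scalerN => hmD.
rewrite /Delta; set y := \val x; have -> : y = ii z by rewrite zx.
have zD : dom Omega (ii z) by left; split; [exact: Ox | exists z].
rewrite (quadE _ hpD) (quadE _ hmD) (quadE _ zD).
rewrite -scalerN !dotM_addZ_sq ?symN // dotMNN dotMNr.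
move: (hstep _ _ _) hp0 (hstep _ _ _) hm0 => hp hp0 hm hm0.
by field; rewrite !lt0r_neq0 ?addr_gt0.
Qed.

Lemma consistent_det_mono (V : {fset 'cV[int]_2}) (D : operator Omega)
    (N N' : 'M[R]_2) :
  grid Omega !=set0 -> DE2 V D ->
  consistency_set D N -> consistency_set D N' ->
  (forall v, v \in V -> dotM N (ii v) (ii v) <= dotM N' (ii v) (ii v)) ->
  \det N <= \det N'.
Proof.
move=> [y /mem_set yX] [_ DE] [[symN _] detN] [[symN' _] detN'] le_NN'.
pose x : grid Omega := SigSub yX.
have [F [Fmono _ DF]] := DE x.
rewrite -(detN x) -(detN' x) !DF; apply: Fmono => i.
by rewrite !mxE !Delta_quad //; apply: le_NN'; apply: mem_nth; exact: ltn_ord.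
Qed.

End Consistency.

(** * Stencil vectors in every sector *)

(** Along [M + t K], where [K] is twice the sum of the squares of the three
    forms [cross], every pair of the superbase has its product decreased by
    [2 t], so the superbase is strictly obtuse. Subtracting in addition [t]
    times the product form of [cross f] and [cross g] moves the product of [f]
    and [g] back up by [t] and leaves the squares of [f] and [g] unchanged,
    hence increases the determinant. If [cross f v * cross g v >= 0] on all of
    [V], it increases the form at no vector of [V], which contradicts
    [consistent_det_mono]. *)
Lemma separating_stencil_vector (R : realType) (Omega : set 'cV[R]_2)
    (V : {fset 'cV[int]_2}) (D : operator Omega) (M : 'M[R]_2)
    (e f g : 'cV[int]_2) :
  open Omega -> grid Omega !=set0 -> DE2 V D -> S2pos M ->
  (\forall N \near within (@S2 R) (nbhs M), consistency_set D N) ->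
  superbase e f g -> obtuse M e f g ->
  exists2 v, v \in V & cross f v * cross g v < 0.
Proof.
move=> Oopen X0 DE [symM _] near_M sb [_ _ Mfg].
have [s s1 [fg ge ef]] := superbase_cross _ _ _ sb.
pose ie := of_int R e; pose jf := of_int R f; pose kg := of_int R g.
pose K := cross_prod ie ie + cross_prod jf jf + cross_prod kg kg.
pose K' := K + (-1) *: cross_prod jf kg.
have symK : S2 K by apply: S2D; first apply: S2D; exact: S2_cross_prod.
have symK' : S2 K' by exact: S2_perturb _ symK (S2_cross_prod _ _ _).
have consistent B : S2 B -> \forall t \near (0 : R)^'+, consistency_set D (M + t *: B).
  move=> symB.
  have cvM : (fun t : R => M + t *: B) @ (0 : R)^'+ --> M.
    apply: cvg_at_right_filter; rewrite -[X in _ --> X]addr0 -(scale0r B).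
    by apply: cvgD; [exact: cvg_cst | apply: cvgZr_tmp; exact: cvg_id].
  have near_t : \forall t \near (0 : R)^'+,
      S2 (M + t *: B) -> consistency_set D (M + t *: B) := cvM _ near_M.
  near=> t; have /(_ (S2_perturb _ _ _ _ symM symB)) // :
    S2 (M + t *: B) -> consistency_set D (M + t *: B) by near: t.
apply: contrapT => noV.
have Vge v : v \in V -> 0 <= cross f v * cross g v.
  by move=> vV; rewrite leNgt; apply/negP => lt0; apply: noV; exists v.
near (0 : R)^'+ => t.
have t0 : 0 < t by near: t; exact: nbhs_right_gt.
have CK : consistency_set D (M + t *: K) by near: t; exact: consistent.
have CK' : consistency_set D (M + t *: K') by near: t; exact: consistent.
have : \det (M + t *: K') <= \det (M + t *: K).
  apply: consistent_det_mono X0 DE CK' CK _ => // v /Vge fgv.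
  rewrite (dotM_perturb _ M K') (dotM_perturb _ M K) lerD2l ler_pM2l //.
  rewrite dotM_perturb dotM_cross_prod !cross_of_int.
  rewrite [X in -1 * (_ + X)]mulrC -!rmorphM /= gerDl mulN1r oppr_le0.
  by rewrite -rmorphD /= ler0z addr_ge0.
have sR : (s%:~R : R) ^+ 2 = 1 by rewrite -rmorphXn /= s1.
have basis : cross jf kg ^+ 2 = 1 by rewrite cross_of_int fg.
rewrite (det_basis _ _ _ _ (S2_perturb _ _ _ _ symM symK) basis).
rewrite (det_basis _ _ _ _ (S2_perturb _ _ _ _ symM symK') basis).
have jk : cross jf kg = s%:~R by rewrite cross_of_int fg.
have ki : cross kg ie = s%:~R by rewrite cross_of_int ge.
have ij : cross ie jf = s%:~R by rewrite cross_of_int ef.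
have kj : cross kg jf = - s%:~R by rewrite crossC jk.
have ik : cross ie kg = - s%:~R by rewrite crossC ki.
have [Kjj Kkk Kjk] : [/\ dotM K jf jf = 4, dotM K kg kg = 4 & dotM K jf kg = -2].
  have KE u v : dotM K u v = 2 * (cross ie u * cross ie v +
      cross jf u * cross jf v + cross kg u * cross kg v).
    rewrite /K (dotMD _ (_ + _)) (dotMD _ (cross_prod ie ie)).
    by rewrite !dotM_cross_prod; ring.
  by rewrite !KE !crossxx ij ik jk kj; split; ring: sR.
have [K'jj K'kk K'jk] :
    [/\ dotM K' jf jf = 4, dotM K' kg kg = 4 & dotM K' jf kg = -1].
  rewrite !(dotM_perturb _ K) Kjj Kkk Kjk !dotM_cross_prod !crossxx jk kj.
  by split; ring: sR.
rewrite !(dotM_perturb _ M) Kjj Kkk Kjk K'jj K'kk K'jk lerD2l lerN2.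
apply/negP; rewrite -ltNge.
have : dotM M jf kg * t <= 0 by rewrite mulr_le0_ge0 // ltW.
have : 0 < t ^+ 2 by rewrite exprn_gt0.
by lra.
Unshelve. all: by end_near. Qed.

(** * The obtuse superbase lies in the hull of the stencil *)

Theorem theorem1p9 (R : realType) (Omega : set 'cV[R]_2)
    (Omega_convex : convex_set Omega) (Omega_open : open Omega)
    (Omega_bounded : bounded_set Omega) (grid_nonempty : grid Omega !=set0)
    (V : {fset 'cV[int]_2}) (D : operator Omega) (D_DE2 : DE2 V D)
    (M : 'M[R]_2) (M_pos : S2pos M) :
  (\forall N \near within (@S2 R) (nbhs M),
     consistency_set D N) ->
  exists e f g : 'cV[int]_2,
    [/\ hull V (of_int R e), hull V (of_int R f), hull V (of_int R g),
        superbase e f g & obtuse M e f g].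
Proof.
move=> near_M.
have [e [f [g [sb ob]]]] := ex_obtuse_superbase _ _ M_pos.
have VN := D_DE2.1.2.
have sector e' f' g' := separating_stencil_vector _ _ _ _ _ e' f' g'
  Omega_open grid_nonempty D_DE2 M_pos near_M.
have sb' := superbase_rot _ _ _ sb; have ob' := obtuse_rot _ _ _ _ _ M_pos.1 ob.
have sb'' := superbase_rot _ _ _ sb'.
have ob'' := obtuse_rot _ _ _ _ _ M_pos.1 ob'.
have v_e := sector _ _ _ sb ob; have v_f := sector _ _ _ sb' ob'.
have v_g := sector _ _ _ sb'' ob''.
exists e, f, g; split=> //.
- exact: (superbase_hull _ _ VN _ _ _ sb v_e v_f v_g).
- exact: (superbase_hull _ _ VN _ _ _ sb' v_f v_g v_e).
- exact: (superbase_hull _ _ VN _ _ _ sb'' v_g v_e v_f).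
Qed.
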